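(* Let $G$ be a finite group. Then $G$ is hereditarily $d$-maximal if and only if one of the following holds: (1) there exist primes $p, q$ such that $G = \langle x \rangle \ltimes Q$, where $\langle x \rangle \cong C_p$ is cyclic of order $p$, $Q$ is an elementary abelian $q$-group and $x$ acts on $Q$ as a non-trivial scalar; (2) there exists a prime $p$ such that $G$ is an elementary abelian $p$-group.
   Context: $d(G)$ denotes the minimal number of generators of a group $G$. A finite group $G$ is $d$-maximal if $d(H) < d(G)$ for all proper subgroups $H$ of $G$, and it is hereditarily $d$-maximal if every subgroup of $G$ (including $G$ itself) is $d$-maximal. An elementary abelian $q$-group $Q$ is regarded as an $\mathbb{F}_q$-vector space; $x$ acts on $Q$ as a non-trivial scalar if conjugation by $x$ on $Q$ is a non-trivial automorphism given by multiplication by some $\lambda \in \mathbb{F}_q^*$. *)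

(* Defs.v *)
From mathcomp Require Import all_boot all_order all_algebra.
From mathcomp Require Import all_fingroup all_solvable.

Set Implicit Arguments.
Unset Strict Implicit.
Unset Printing Implicit Defensive.

Local Open Scope group_scope.

(* The minimal number of generators d(G) is the library's 'm(G). *)
Definition d_maximal (gT : finGroupType) (G : {group gT}) : Prop :=
  forall H : {group gT}, H \proper G -> 'm(H) < 'm(G).

Definition hereditarily_d_maximal (gT : finGroupType) (G : {group gT}) : Prop :=
  forall H : {group gT}, H \subset G -> d_maximal H.

(* In multiplicative notation, the scalar multiple of y by lambda in the
   F_q-vector space Q is the power y ^+ lambda. Non-triviality is asked of the
   automorphism rather than of lambda: when Q = 1 every scalar acts trivially. *)
Definition acts_as_nontrivial_scalar (gT : finGroupType) (q : nat)
    (x : gT) (Q : {group gT}) : Prop :=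
  (exists lambda : 'F_q,
     lambda != 0%R /\ (forall y : gT, y \in Q -> y ^ x = y ^+ lambda))
  /\ (exists2 y : gT, y \in Q & y ^ x != y).

(* Main.v *)
Require Import Defs.
From mathcomp Require Import all_boot all_order all_algebra.
From mathcomp Require Import all_fingroup all_solvable.

Set Implicit Arguments.
Unset Strict Implicit.
Unset Printing Implicit Defensive.

Local Open Scope group_scope.

(** Write [m(H)] for the minimal number of generators of [H].

    Why the groups listed are hereditarily d-maximal.  If [Q] is an elementary
    abelian q-group then [m(Q)] is its dimension, which drops in proper
    subgroups.  If [G] extends such a [Q] by a group of prime order whose
    nontrivial elements act as scalars other than 1, then a subgroup [H] outside
    [Q] is an extension of the same kind, of [H :&: Q], and
    [m(H) = dim (H :&: Q) + 1] ([grank_fpf_power_extension]): among any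
    generators one, [t], lies outside [Q]; the others can be multiplied by
    powers of [t] until they lie in [Q], and as every subspace of [Q] is
    invariant, what they then span is already [H :&: Q].  This formula is
    strictly monotone in [H].

    Why there are no others.  In a hereditarily d-maximal group [m] increases
    strictly along every chain of subgroups.  So cyclic subgroups are trivial or
    of prime order, and in a 2-generated subgroup no chain has length above 2.
    Counting the conjugates of non-normal subgroups shows that a group of the
    latter kind has a normal subgroup of prime order unless it is trivial
    ([length2_normal]); hence its order is a product of at most two primes
    ([hdm_grank2_order]).  Applied to the subgroup generated by two elements
    [x], [y] of prime order this gives two rules: if [x] has smaller order
    than [y], then [x] normalises [<[y]>] ([hdm_lt_order_norm]); if both have
    the largest prime order [q] dividing the order of [G], they commute
    ([hdm_max_order_commute]).

    By the second rule the elements of order [q], with 1, form a normal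
    elementary abelian Sylow subgroup [Q]; by the first, all of [G] normalises
    each cyclic subgroup of [Q].  Nothing outside [Q] centralises a nontrivial
    [y] in [Q], because no element has order a product of two primes.  So
    [G / Q] embeds in the cyclic group [Aut <[y]>], and [G] is generated by [Q]
    and one element [s], of prime order if it is nontrivial modulo [Q].
    Finally, an automorphism of [Q] that stabilises every line is a scalar
    ([abelem_power_aut_scalar]). *)

(** * Extensions by a fixed-point-free scalar action *)

Lemma grank_abelem (gT : finGroupType) (q : nat) (R : {group gT}) :
  q.-abelem R -> 'm(R) = logn q #|R|.
Proof.
by move=> abR; rewrite grank_abelian ?(abelem_abelian abR) ?(rank_abelem abR).
Qed.

(** Both the semidirect products of the theorem, with [Q] nontrivial, and the
    groups of prime order, with [Q = 1], have this form.  No complement of [Q]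
    is named, which is what lets the notion pass to subgroups: [H :&: Q] plays
    the part of [Q], whichever complements [H] contains. *)
Definition fpf_power_extension (gT : finGroupType) (q : nat)
    (G Q : {group gT}) : Prop :=
  [/\ q.-abelem Q, Q <| G, prime #|G : Q|,
      {in Q^#, forall y, 'C_G[y] \subset Q}
    & {in Q, forall y, G \subset 'N(<[y]>)}].

(** Since [Q] has prime index, [H] covers [G / Q], so [H :&: Q] has that index
    in [H]. *)
Lemma fpf_power_extensionS (gT : finGroupType) (q : nat)
    (G Q H : {group gT}) :
    fpf_power_extension q G Q -> H \subset G -> ~~ (H \subset Q) ->
  fpf_power_extension q H (H :&: Q).
Proof.
case=> abQ nsQG prQ cQ nyQ sHG not_sHQ.
have maxQ : maximal Q G by apply: p_index_maximal (normal_sub nsQG) prQ.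
have defG : Q * H = G by rewrite (mulg_normal_maximal nsQG maxQ).
split.
- exact: abelemS (subsetIr _ _) abQ.
- exact: normalGI sHG nsQG.
- by rewrite /= indexgI -indexMg defG.
- move=> y /setD1P[nty /setIP[_ Qy]]; rewrite subsetI subsetIl /=.
  by apply: subset_trans (setSI _ sHG) (cQ y _); rewrite !inE nty.
- by move=> y /setIP[_ Qy]; apply: subset_trans sHG (nyQ y Qy).
Qed.

(** Any [s] outside [R] generates a complement, as it centralises
    [R :&: <[s]>].  Adding [s] to a basis of [R] gives generators of [H].
    Conversely, let [t] outside [R] belong to a generating set [S], and replace
    each other member of [S] by its component in [R] along [<[t]>].  The span of
    these components is invariant under [t], so together with [t] it gives [H]
    and must be the whole of [R]. *)
Lemma grank_fpf_power_extension (gT : finGroupType) (q : nat)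
    (H R : {group gT}) :
  fpf_power_extension q H R -> 'm(H) = (logn q #|R|).+1.
Proof.
case=> abR nsRH prR cR nyR; have [sRH nRH] := andP nsRH.
have maxR : maximal R H by apply: p_index_maximal.
have compl s: s \in H -> s \notin R -> R * <[s]> = H /\ R :&: <[s]> = 1.
  move=> Hs notRs; split.
    by apply: mulg_normal_maximal; rewrite ?cycle_subG.
  apply/trivgP/subsetP=> z /setIP[Rz /cycleP[i def_z]].
  apply: contraR notRs => ntz.
  apply: (subsetP (cR z _)); first by rewrite in_setD Rz ntz.
  by rewrite inE Hs cent1C def_z groupX ?cent1id.
have [s Hs notRs] : exists2 s, s \in H & s \notin R.
  by apply/subsetPn; apply: contraL prR; rewrite -indexg_eq1 => /eqP->.
apply/eqP; rewrite -(grank_abelem abR) eqn_leq; apply/andP; split.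
  have [[defH _] [B defR <-]] := (compl s Hs notRs, grank_witness R).
  suff ->: H :=: <<s |: B>>.
    by rewrite (leq_trans (grank_min _)) // cardsU1; case: (s \notin B).
  apply/eqP; rewrite eqEsubset gen_subG subUset sub1set Hs.
  rewrite (subset_trans _ sRH) -?defR ?subset_gen // andbT -defH -defR.
  rewrite andbT mul_subG //; first by rewrite genS ?subsetUr.
  by rewrite cycle_subG mem_gen ?setU11.
have [S defS <-] := grank_witness H.
have [t St notRt]: exists2 t, t \in S & t \notin R.
  by apply/subsetPn; apply: contra notRs; rewrite -gen_subG defS => /subsetP->.
have Ht : t \in H by rewrite -defS mem_gen.
have [defH tiRt] := compl t Ht notRt.
pose f := divgr R <[t]>; pose B := f @: (S :\ t).
have sBR : B \subset R.
  apply/subsetP=> _ /imsetP[u /setD1P[_ Su] ->]; apply: mem_divgr.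
  by rewrite defH -defS mem_gen.
have nBt : <[t]> \subset 'N(<<B>>).
  rewrite cycle_subG inE; apply/subsetP=> _ /imsetP[y By ->].
  have Ry : y \in R by apply: (subsetP _ y By); rewrite gen_subG.
  have : y ^ t \in <[y]> by rewrite memJ_norm ?cycle_id // (subsetP (nyR y Ry)).
  by apply: (subsetP _); rewrite cycle_subG.
have defH' : <<B>> * <[t]> = H.
  apply/eqP; rewrite eqEsubset mul_subG ?cycle_subG //=; last first.
    by rewrite (subset_trans _ sRH) ?gen_subG.
  rewrite -norm_joinEr // -{1}defS gen_subG; apply/subsetP=> u Su.
  have [-> | neq_ut] := eqVneq u t; first by rewrite mem_gen // inE cycle_id orbT.
  rewrite (divgr_eq R <[t]> u) groupM //.
    by rewrite (subsetP (joing_subl _ _)) ?mem_gen ?imset_f // !inE neq_ut.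
  by rewrite (subsetP (joing_subr _ _)) // mem_remgr // defH -defS mem_gen.
(* By the modular law, as R meets <[t]> trivially. *)
have defR : <<B>> = R.
  have: <<B>> * (<[t]> :&: R) = R.
    by rewrite group_modl ?gen_subG // defH' (setIidPr sRH).
  by rewrite setIC tiRt mulg1.
apply: leq_trans (_ : #|B|.+1 <= _); first by rewrite ltnS -{1}defR grank_min.
by rewrite (cardsD1 t S) St add1n ltnS leq_imset_card.
Qed.

(** Subgroups outside [Q] have the rank of their intersection with [Q] plus one,
    those inside [Q] just that rank.  In a proper inclusion the rank of the
    intersection drops, or else the smaller group is inside [Q] and the larger
    one is not. *)
Lemma fpf_power_extension_hereditary (gT : finGroupType) (q : nat)
    (G Q : {group gT}) :
  fpf_power_extension q G Q -> hereditarily_d_maximal G.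
Proof.
move=> extG H sHG K ltKH; have sKG := subset_trans (proper_sub ltKH) sHG.
have [abQ nsQG prQ _ _] := extG; have qQ := abelem_pgroup abQ.
have leKH : logn q #|K :&: Q| <= logn q #|H :&: Q|.
  by rewrite dvdn_leq_log ?cardG_gt0 // cardSg // setSI // proper_sub.
have grank_out (L : {group gT}) : L \subset G -> ~~ (L \subset Q) ->
  'm(L) = (logn q #|L :&: Q|).+1.
- move=> sLG notLQ.
  exact: grank_fpf_power_extension (fpf_power_extensionS extG sLG notLQ).
have grank_in (L : {group gT}) : L \subset Q -> 'm(L) = logn q #|L :&: Q|.
  by move=> sLQ; rewrite (setIidPl sLQ); apply/grank_abelem/(abelemS sLQ).
have [sHQ | notHQ] := boolP (H \subset Q).
  have sKQ := subset_trans (proper_sub ltKH) sHQ.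
  rewrite !grank_in // (setIidPl sKQ) (setIidPl sHQ).
  by rewrite (properG_ltn_log (pgroupS sHQ qQ)).
have [sKQ | notKQ] := boolP (K \subset Q).
  by rewrite grank_in // grank_out.
rewrite !grank_out // ltnS (properG_ltn_log (pgroupS (subsetIr _ _) qQ)) //.
rewrite properEneq setSI ?proper_sub // andbT; apply: contraTneq (ltKH) => eqI.
(* H and K both cover G / Q, hence have equal orders. *)
have cardL (L : {group gT}) : L \subset G -> ~~ (L \subset Q) ->
  (#|Q| * #|L|)%N = (#|G| * #|L :&: Q|)%N.
- have maxQ := p_index_maximal (normal_sub nsQG) prQ.
  by move=> sLG notLQ; rewrite mul_cardG (mulg_normal_maximal nsQG maxQ) // setIC.
apply/negP=> /proper_card; apply/negP.
by rewrite -leqNgt -(leq_pmul2l (cardG_gt0 Q)) !cardL // eqI.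
Qed.

(** If [y] in [Q] is nontrivial, ['C_G[y]] contains [Q], which is maximal; were
    [x] to fix [y], its scalar would be 1. *)
Lemma scalar_fpf_power_extension (gT : finGroupType) (p q : nat) (x : gT)
    (G Q : {group gT}) :
    prime p -> prime q -> #[x] = p -> Q ><| <[x]> = G -> q.-abelem Q ->
    acts_as_nontrivial_scalar q x Q ->
  fpf_power_extension q G Q.
Proof.
move=> pr_p pr_q ox defG abQ [[lam [_ scal]] [y0 Qy0 mov_y0]].
have [nsQG sxG defQx nQx _] := sdprod_context defG.
have prQ : prime #|G : Q| by rewrite -(index_sdprod defG) -orderE ox.
have cQQ := abelem_abelian abQ.
have norm y : y \in Q -> G \subset 'N(<[y]>).
  move=> Qy; rewrite -defQx mul_subG //.
    by rewrite cents_norm // centsC cycle_subG (subsetP cQQ).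
  rewrite cycle_subG inE -cycleJ cycle_subG scal //; exact: mem_cycle.
split=> //.
have maxQ := p_index_maximal (normal_sub nsQG) prQ.
move=> y /setD1P[nty Qy]; apply: contraR mov_y0 => notCQ.
have cyG : G \subset 'C[y].
  have := mulg_normal_maximal nsQG maxQ (subsetIl G 'C[y]) notCQ.
  rewrite mulSGid => [<- |]; first exact: subsetIr.
  by rewrite subsetI (normal_sub nsQG) sub_cent1 (subsetP cQQ).
have fix_y : y ^+ lam = y.
  rewrite -scal //; apply/conjg_fixP/commgP/cent1P.
  by rewrite cent1C (subsetP cyG) -?cycle_subG.
have oy : #[y] = q by apply: abelem_order_p abQ _ _.
have: y ^+ lam == y ^+ 1 by rewrite fix_y.
rewrite eq_expg_mod_order oy => lam1.
rewrite scal // -[X in _ == X]expg1 eq_expg_mod_order.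
have [-> | nty0] := eqVneq y0 1; first by rewrite order1 !modn1.
by rewrite (abelem_order_p abQ).
Qed.

(** * Subgroup chains in hereditarily d-maximal groups *)

Lemma hereditarily_d_maximalS (gT : finGroupType) (G H : {group gT}) :
  H \subset G -> hereditarily_d_maximal G -> hereditarily_d_maximal H.
Proof. by move=> sHG dG K sKH; apply/dG/(subset_trans sKH). Qed.

Lemma grank_le0 (gT : finGroupType) (G : {group gT}) : 'm(G) <= 0 -> G :=: 1.
Proof.
have [B <- <-] := grank_witness G; rewrite leqn0 cards_eq0 => /eqP->.
exact: gen0.
Qed.

Lemma proper_sub1_prime (gT : finGroupType) (G : {group gT}) :
    G :!=: 1 -> (forall H : {group gT}, H \proper G -> H :=: 1) ->
  prime #|G|.
Proof.
rewrite -cardG_gt1 => /[dup] ntG /pdiv_prime pr_p simpG.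
have [x Gx ox] := Cauchy pr_p (pdiv_dvd #|G|).
rewrite -cycle_subG in Gx.
have [defG | neqG] := eqVneq (<[x]> : {set gT}) G.
  by rewrite -defG -orderE ox.
have /simpG/eqP : <[x]> \proper G by rewrite properEneq neqG.
by rewrite cycle_eq1 -order_eq1 ox => /eqP p1; rewrite p1 in pr_p.
Qed.

Lemma hdm_order_prime (gT : finGroupType) (G : {group gT}) (x : gT) :
  hereditarily_d_maximal G -> x \in G -> x != 1 -> prime #[x].
Proof.
move=> dG Gx ntx; apply: proper_sub1_prime; first by rewrite cycle_eq1.
move=> H ltHx; apply: grank_le0; rewrite -ltnS.
apply: leq_trans (dG <[x]>%G _ _ ltHx) _; first by rewrite cycle_subG.
by rewrite (leq_trans (grank_min _)) ?cards1.
Qed.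

(** * Groups whose chains of subgroups have length at most 2 *)

Definition length_le2 (gT : finGroupType) (G : {group gT}) : Prop :=
  forall H K : {group gT}, H \proper G -> K \proper H -> K :=: 1.

(** The numbers of generators of three subgroups in a proper chain are distinct,
    so the smallest of them is generated by no element at all. *)
Lemma hdm_length_le2 (gT : finGroupType) (G : {group gT}) :
  hereditarily_d_maximal G -> 'm(G) <= 2 -> length_le2 G.
Proof.
move=> dG mG H K ltHG ltKH; apply: grank_le0.
have mH := dG G (subxx _) H ltHG; have mK := dG H (proper_sub ltHG) K ltKH.
by rewrite -2!ltnS (leq_trans _ mG) // (leq_ltn_trans mK).
Qed.

(** Here [M] is maximal, hence its own normaliser when it is not normal, and has
    prime order, hence meets its other conjugates trivially. *)
Lemma length2_normedTI (gT : finGroupType) (G M : {group gT}) :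
  length_le2 G -> M \proper G -> M :!=: 1 -> ~~ (M <| G) -> normedTI M^# G M.
Proof.
move=> length2 ltMG ntM not_nMG; have sMG := proper_sub ltMG.
have defN : 'N_G(M) = M.
  apply/eqP; rewrite eq_sym eqEproper subsetI sMG normG /=.
  apply: contra ntM => ltMN; apply/eqP/(length2 _ _ _ ltMN).
  rewrite properEneq subsetIl andbT; apply: contra not_nMG.
  by move/eqP/setIidPl; rewrite /normal sMG.
apply/normedTI_P; split; first by rewrite setD_eq0 subG1.
  by rewrite normD1 defN.
move=> g Gg; rewrite -setI_eq0 conjD1g -setDIl setD_eq0 subG1 => ntI.
have sMMg : M \subset M :^ g.
  apply: contraR ntI => not_sMMg; apply/eqP/(length2 _ _ ltMG).
  by rewrite properE subsetIl subsetI subxx.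
rewrite -defN inE Gg; apply/normP/esym/eqP.
by rewrite eqEcard sMMg cardJg leqnn.
Qed.

Lemma length2_prime (gT : finGroupType) (G M : {group gT}) :
  length_le2 G -> M \proper G -> M :!=: 1 -> prime #|M|.
Proof.
move=> length2 ltMG ntM; apply: proper_sub1_prime => // H.
exact: (length2 _ _ ltMG).
Qed.

(** An abelian [G] has a subgroup of prime order, so let [G] be nonabelian; its
    cyclic subgroups are proper.  If [<[y]>] is not normal, its nontrivial
    elements have [#|G| - #|G : <[y]>|] conjugates, at least half of [#|G|] but
    fewer than [#|G| - 1].  So if [<[x]>] is not normal, some nontrivial [z] is conjugate
    into it by no element; were [<[z]>] not normal either, the two sets of
    conjugates would be disjoint and leave no room for 1. *)
Lemma length2_normal (gT : finGroupType) (G : {group gT}) :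
    length_le2 G -> ~~ prime #|G| -> G :!=: 1 ->
  exists N : {group gT}, [/\ N <| G, N \proper G & N :!=: 1].
Proof.
move=> length2 not_prG ntG.
have [abG | not_abG] := boolP (abelian G).
  have [p pr_p /Cauchy[//|x Gx ox]]: exists2 p, prime p & p %| #|G|.
    by exists (pdiv #|G|); rewrite ?pdiv_dvd ?pdiv_prime ?cardG_gt1.
  have sxG : <[x]> \subset G by rewrite cycle_subG.
  exists <[x]>%G; split; first by rewrite /= -sub_abelian_normal.
    rewrite properEneq sxG andbT; apply: contra not_prG => /eqP <-.
    by rewrite -orderE ox.
  by rewrite cycle_eq1 -order_eq1 ox; apply: contraTneq pr_p => ->.
have ltCG z : z \in G -> <[z]> \proper G.
  move=> Gz; rewrite properEneq cycle_subG Gz andbT.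
  apply: contra not_abG => /eqP <-.
  exact: cycle_abelian.
have [x Gx ntx] := trivgPn _ ntG.
pose S y := class_support <[y]>^# G.
have [nxG | not_nxG] := boolP (<[x]> <| G).
  by exists <[x]>%G; rewrite ltCG ?cycle_eq1.
have cardS y : y \in G -> y != 1 -> ~~ (<[y]> <| G) ->
  (#|S y| + #|G : <[y]>| = #|G|)%N.
- move=> Gy nty not_nyG.
  have ntyS : <[y]> :!=: 1 by rewrite cycle_eq1.
  rewrite (card_support_normedTI (length2_normedTI length2 (ltCG y Gy) ntyS _)) //.
  rewrite addnC -mulSn -(Lagrange (proper_sub (ltCG y Gy))).
  by rewrite [in RHS](cardsD1 1 <[y]>) group1.
have halfS y : y \in G -> y != 1 -> ~~ (<[y]> <| G) -> #|G| <= #|S y| * 2.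
  move=> Gy nty not_nyG; rewrite -(leq_add2r (#|G : <[y]>| * 2)) -mulnDl cardS //.
  rewrite [leqRHS]muln2 -addnn leq_add2l.
  rewrite -(Lagrange (proper_sub (ltCG y Gy))) mulnC.
  by rewrite leq_mul2r cardG_gt1 cycle_eq1 nty orbT.
have sSG y : y \in G -> S y \subset G^#.
  move=> Gy; apply/subsetP=> _ /imset2P[a g /setD1P[nta ya] Gg ->].
  by rewrite !inE conjg_eq1 nta groupJ // (subsetP _ a ya) ?cycle_subG.
have [z /setD1P[ntz Gz] not_Sz] : exists2 z, z \in G^# & z \notin S x.
  apply/subsetPn/negP=> /subset_leq_card.
  apply/negP; rewrite -ltnNge -(ltn_add2r #|G : <[x]>|) cardS //.
  rewrite (cardsD1 1 G) group1 addnC ltn_add2l indexg_gt1.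
  by have /andP[] := ltCG x Gx.
have [nzG | not_nzG] := boolP (<[z]> <| G).
  by exists <[z]>%G; rewrite ltCG ?cycle_eq1.
have tiS : S x :&: S z = set0.
  apply/setP=> w; rewrite inE in_set0; apply: contraNF not_Sz.
  case/andP=> /imset2P[a g /setD1P[nta xa] Gg def_w].
  case/imset2P=> [b h /setD1P[ntb zb] Gh def_w'].
  (* A nontrivial element b of <[z]>, conjugate into <[x]>, generates <[z]>. *)
  have def_z : <[b]> = <[z]>.
    apply/eqP; apply: contraNT ntb => neq_bz.
    rewrite -cycle_eq1; apply/eqP/(length2 _ _ (ltCG z Gz)).
    by rewrite properEneq neq_bz cycle_subG.
  have /cycleP[i def_zi] : z \in <[b]> by rewrite def_z cycle_id.
  have def_zai : z = (a ^+ i) ^ (g * h^-1).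
    by rewrite conjgM conjXg -def_w def_w' -conjXg conjgK.
  apply/imset2P; exists (a ^+ i) (g * h^-1); rewrite ?groupM ?groupV //.
  by rewrite !inE groupX // andbT -(conjg_eq1 _ (g * h^-1)) -def_zai.
have: #|S x :|: S z| < #|G|.
  rewrite [X in _ < X](cardsD1 1) group1 add1n ltnS subset_leq_card //.
  by rewrite subUset !sSG.
rewrite ltnNge cardsU tiS cards0 subn0 -(leq_pmul2r (_ : 0 < 2)) //.
by rewrite mulnDl muln2 -addnn leq_add ?halfS.
Qed.

(** * Subgroups generated by two elements *)

(** When the order of [H] is not prime, [H] has a normal subgroup [N] of prime
    order, maximal because chains have length at most 2; so [H] is [N] times the
    group generated by any element outside [N], which has prime order too. *)
Lemma hdm_grank2_order (gT : finGroupType) (H : {group gT}) (q : nat) :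
    hereditarily_d_maximal H -> 'm(H) <= 2 -> prime q -> q %| #|H| ->
  exists2 r, #|H| = (q * r)%N & (r == 1%N) || prime r.
Proof.
move=> dH mH pr_q qH.
have lenH := hdm_length_le2 dH mH.
have [pr_H | not_pr_H] := boolP (prime #|H|).
  by exists 1%N; rewrite // muln1; apply/esym/eqP; rewrite -dvdn_prime2.
have ntH : H :!=: 1.
  rewrite -cardG_gt1; apply: leq_trans (prime_gt1 pr_q) _.
  exact: dvdn_leq (cardG_gt0 H) qH.
have [N [nsNH ltNH ntN]] := length2_normal lenH not_pr_H ntH.
have pr_N := length2_prime lenH ltNH ntN.
have [s Hs notNs] := subsetPn (proper_subn ltNH).
have nts : s != 1 by apply: contraNneq notNs => ->.
have pr_s : prime #[s] := hdm_order_prime dH Hs nts.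
have defH : N * <[s]> = H.
  have nNs : <[s]> \subset 'N(N).
    by rewrite (subset_trans _ (normal_norm nsNH)) ?cycle_subG.
  rewrite -norm_joinEr //; apply/eqP; rewrite eqEproper join_subG.
  rewrite (proper_sub ltNH) cycle_subG Hs /=; apply: contra ntN => ltNsH.
  apply/eqP/(lenH (N <*> <[s]>)%G) => //.
  rewrite properE joing_subl join_subG subxx cycle_subG /=.
  exact: notNs.
have cardH : #|H| = (#|N| * #[s])%N.
  by rewrite -defH TI_cardMg // setIC prime_TIg // cycle_subG.
move: qH; rewrite cardH Euclid_dvdM // !dvdn_prime2 //.
case/orP=> /eqP->; first by exists #[s]; rewrite ?pr_s ?orbT.
by exists #|N|; rewrite ?pr_N ?orbT // mulnC.
Qed.

Lemma hdm_two_gen (gT : finGroupType) (G : {group gT}) (x y : gT) :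
    hereditarily_d_maximal G -> x \in G -> y \in G ->
  exists H : {group gT},
    [/\ H \subset G, x \in H, y \in H, hereditarily_d_maximal H & 'm(H) <= 2].
Proof.
move=> dG Gx Gy; exists <<[set x; y]>>%G.
have sHG : <<[set x; y]>> \subset G by rewrite gen_subG subUset !sub1set Gx.
split=> //; try by rewrite mem_gen ?set21 ?set22.
  exact: hereditarily_d_maximalS sHG dG.
by rewrite (leq_trans (grank_min _)) // cards2; case: (x != y).
Qed.

(** Otherwise they meet trivially, and their product has [q * q] elements. *)
Lemma prime_order_sub_uniq (gT : finGroupType) (H A B : {group gT}) (q : nat) :
    prime q -> #|A| = q -> #|B| = q -> A \subset H -> B \subset H ->
    #|H| < q * q ->
  A :=: B.
Proof.
move=> pr_q oA oB sAH sBH; rewrite ltnNge; apply: contraNeq => neqAB.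
have tiAB : A :&: B = 1.
  apply: prime_TIg; first by rewrite oA.
  by apply: contra neqAB => sAB; rewrite eqEcard sAB oA oB leqnn.
by rewrite -{1}oA -{1}oB -TI_cardMg // subset_leq_card // mul_subG.
Qed.

(** The subgroup generated by [x] and [y] has order [#[x] * #[y]], too small to
    contain a conjugate of [<[y]>] other than itself. *)
Lemma hdm_lt_order_norm (gT : finGroupType) (G : {group gT}) (x y : gT) :
    hereditarily_d_maximal G -> x \in G -> y \in G -> x != 1 -> #[x] < #[y] ->
  x \in 'N(<[y]>).
Proof.
move=> dG Gx Gy ntx ltxy.
have nty : y != 1.
  by apply: contraTneq ltxy => ->; rewrite order1 ltnNge order_gt0.
have [H [sHG Hx Hy dH mH]] := hdm_two_gen dG Gx Gy.
have pr_x := hdm_order_prime dG Gx ntx; have pr_y := hdm_order_prime dG Gy nty.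
have [r oH pr_r] := hdm_grank2_order dH mH pr_y (order_dvdG Hy).
have xr : #[x] %| r.
  have := order_dvdG Hx; rewrite oH Euclid_dvdM // dvdn_prime2 //.
  by rewrite ltn_eqF.
have def_r : r = #[x].
  case/predU1P: pr_r xr => [-> | pr_r]; last by rewrite dvdn_prime2 // => /eqP.
  by rewrite dvdn1 order_eq1 (negPf ntx).
apply/normP/esym; apply: (@prime_order_sub_uniq _ H _ (<[y]> :^ x)%G #[y]) => //=.
- by rewrite cardJg.
- by rewrite cycle_subG.
- by rewrite -cycleJ cycle_subG groupJ.
by rewrite oH def_r ltn_pmul2l ?order_gt0.
Qed.

(** The subgroup generated by [x] and [y] has order [q * r] with [r <= q].  If
    [r = q] it is abelian; if [r < q] it has only one subgroup of order [q]. *)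
Lemma hdm_max_order_commute (gT : finGroupType) (G : {group gT}) (x y : gT)
    (q : nat) :
    hereditarily_d_maximal G -> x \in G -> y \in G -> prime q ->
    #[x] = q -> #[y] = q -> (forall r, prime r -> r %| #|G| -> r <= q) ->
  commute x y.
Proof.
move=> dG Gx Gy pr_q ox oy max_q.
have [H [sHG Hx Hy dH mH]] := hdm_two_gen dG Gx Gy.
have qH : q %| #|H| by rewrite -{1}ox order_dvdG.
have [r oH pr_r] := hdm_grank2_order dH mH pr_q qH.
have [eq_rq | neq_rq] := eqVneq r q.
  have /centsP cHH : abelian H.
    by apply: card_p2group_abelian pr_q _; rewrite oH eq_rq.
  exact: cHH.
have lt_rq : r < q.
  rewrite ltn_neqAle neq_rq; case/predU1P: pr_r oH => [-> _ | pr_r oH].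
    exact: prime_gt0.
  by apply: max_q => //; rewrite (dvdn_trans _ (cardSg sHG)) // oH dvdn_mull.
have defx : <[x]> = <[y]>.
  apply: (@prime_order_sub_uniq _ H _ _ q) => //=; rewrite ?cycle_subG //.
  by rewrite oH ltn_pmul2l ?prime_gt0.
have /cycleP[i ->] : x \in <[y]> by rewrite -defx cycle_id.
exact/commute_sym/commuteX.
Qed.

(** * Structure of hereditarily d-maximal groups *)

(** Fix a nontrivial [y], with [y ^ x = y ^+ n].  If [z] is independent of [y],
    comparing the components of [(y * z) ^ x], a power of [y * z], shows that
    [z] is raised to the power [n] as well. *)
Lemma abelem_power_aut_scalar (gT : finGroupType) (q : nat) (Q : {group gT})
    (x : gT) :
    prime q -> q.-abelem Q -> {in Q, forall y, y ^ x \in <[y]>} ->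
  exists n, {in Q, forall y, y ^ x = y ^+ n}.
Proof.
move=> pr_q abQ powx; have cQQ := abelem_abelian abQ.
have [Q1 | /trivgPn[y Qy nty]] := eqVneq (Q : {set gT}) 1.
  by exists 0%N => y; rewrite Q1 => /set1P->; rewrite conj1g.
have /cycleP[n yx] := powx y Qy; exists n => z Qz.
have [/cycleP[i ->] | not_yz] := boolP (z \in <[y]>).
  by rewrite conjXg yx expgnAC.
have ntz : z != 1 by apply: contraNneq not_yz => ->.
have tiyz : <[y]> :&: <[z]> = 1.
  by rewrite setIC prime_TIg ?cycle_subG // -orderE (abelem_order_p abQ).
have /cycleP[m zx] := powx z Qz.
have /cycleP[k yzx] := powx (y * z) (groupM Qy Qz).
have eq_yz : y ^- k * y ^+ n = z ^+ k * z ^- m.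
  apply: (canRL (mulgK _)); rewrite -mulgA; apply: (canLR (mulKg _)).
  by rewrite -yx -zx -conjMg yzx expgMn //; apply: (centsP cQQ).
have yk1 : y ^- k * y ^+ n = 1.
  apply/set1P; rewrite -set1gE -tiyz inE {2}eq_yz.
  by rewrite !groupM ?groupV ?mem_cycle.
have zk1 : z ^+ k * z ^- m = 1 by rewrite -eq_yz.
have eq_kn : k = n %[mod q].
  apply/eqP; rewrite -(abelem_order_p abQ Qy nty) -eq_expg_mod_order.
  by rewrite eq_mulVg1 yk1.
apply/eqP; rewrite zx -(eqP (_ : z ^+ k == z ^+ m)); last first.
  by rewrite eq_mulgV1 zk1.
by rewrite eq_expg_mod_order (abelem_order_p abQ) // eq_kn.
Qed.

(** Take [q] the largest prime dividing [#|G|] and [Q] a Sylow q-subgroup.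
    Elements of order [q] commute, so all of them are in [Q]; elements outside
    [Q] have smaller prime order and normalise the subgroups [<[y]>] of [Q]. *)
Lemma hdm_structure (gT : finGroupType) (G : {group gT}) :
    hereditarily_d_maximal G -> G :!=: 1 ->
  exists (q : nat) (Q : {group gT}),
    [/\ prime q /\ q.-abelem Q, Q <| G, Q :!=: 1,
        {in Q^#, forall y, 'C_G[y] \subset Q}
      & {in Q, forall y, G \subset 'N(<[y]>)}].
Proof.
move=> dG ntG; pose q := max_pdiv #|G|.
have pr_q : prime q by rewrite max_pdiv_prime ?cardG_gt1.
have max_q r : prime r -> r %| #|G| -> r <= q.
  by move=> pr_r rG; rewrite max_pdiv_max // mem_primes pr_r cardG_gt0.
have [Q sylQ] := Sylow_exists q G; have [sQG qQ _] := and3P sylQ.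
have ordQ y : y \in Q -> y != 1 -> #[y] = q.
  move=> Qy nty; have := mem_p_elt qQ Qy; rewrite /p_elt pnatE ?inE => [/eqP //|].
  exact: hdm_order_prime (subsetP sQG y Qy) nty.
have cQ g y : g \in G -> #[g] = q -> y \in Q -> commute g y.
  move=> Gg og Qy; have [-> | nty] := eqVneq y 1; first exact: commute1.
  have Gy := subsetP sQG y Qy.
  exact: hdm_max_order_commute dG Gg Gy pr_q og (ordQ y Qy nty) max_q.
have memQ g : g \in G -> #[g] = q -> g \in Q.
  move=> Gg og; have nQg : <[g]> \subset 'N(Q).
    rewrite cycle_subG (subsetP (cent_sub Q)) //; apply/centP=> y; exact: cQ.
  rewrite -cycle_subG -(sub_pHall sylQ (K := (Q <*> <[g]>)%G)) /=;
    rewrite ?joing_subr ?joing_subl //.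
    by rewrite norm_joinEr // pgroupM qQ /pgroup -orderE og pnat_id.
  by rewrite join_subG sQG cycle_subG.
have cQQ : abelian Q.
  apply/centsP=> y Qy z Qz; have [-> | nty] := eqVneq y 1.
    exact/commute_sym/commute1.
  by apply: cQ => //; [apply: (subsetP sQG) | apply: ordQ].
have abQ : q.-abelem Q.
  rewrite abelemE // cQQ; apply/exponentP=> y Qy.
  have [-> | nty] := eqVneq y 1; first exact: expg1n.
  by rewrite -(ordQ y) ?expg_order.
have nsQG : Q <| G.
  apply/normalP; split=> // g Gg; apply/eqP; rewrite eqEcard cardJg leqnn andbT.
  apply/subsetP=> _ /imsetP[y Qy ->]; have [-> | nty] := eqVneq y 1.
    by rewrite conj1g.
  by rewrite memQ ?orderJ ?ordQ // groupJ // (subsetP sQG).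
have ltq g : g \in G -> g \notin Q -> prime #[g] /\ #[g] < q.
  move=> Gg notQg; have ntg : g != 1 by apply: contraNneq notQg => ->.
  have pr_g := hdm_order_prime dG Gg ntg; split=> //.
  rewrite ltn_neqAle max_q ?order_dvdG // andbT.
  by apply: contra notQg => /eqP; apply: memQ.
exists q, Q; split=> //.
- rewrite trivg_card1 (card_Hall sylQ) p_part_eq1; apply/negP/negPn.
  by rewrite mem_primes pr_q cardG_gt0 max_pdiv_dvd.
- move=> y /setD1P[nty Qy]; apply/subsetP=> g /setIP[Gg /cent1P cyg].
  apply: contraT => /(ltq g Gg)[pr_g lt_gq]; have Gy := subsetP sQG y Qy.
  have oy := ordQ y Qy nty.
  (* Commuting elements of distinct prime orders have a product of composite
     order. *)
  have ogy : #[g * y] = (#[g] * q)%N.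
    rewrite -oy orderM // oy prime_coprime // dvdn_prime2 //.
    by rewrite ltn_eqF.
  have := hdm_order_prime dG (groupM Gg Gy); rewrite -order_eq1 ogy.
  rewrite muln_eq1 gtn_eqF ?prime_gt1 //= => /(_ isT) pr_gq.
  have : q %| #[g] * q by rewrite dvdn_mull.
  rewrite dvdn_prime2 // -{1}[q]mul1n eqn_pmul2r ?prime_gt0 //.
  by rewrite ltn_eqF ?prime_gt1.
move=> y Qy; apply/subsetP=> g Gg; have [Qg | notQg] := boolP (g \in Q).
  by rewrite (subsetP (cent_sub _)) // cent_cycle; apply/cent1P/(centsP cQQ).
have [-> | nty] := eqVneq y 1; first by rewrite cycle1 norm1 inE.
have [pr_g lt_gq] := ltq g Gg notQg.
apply: (hdm_lt_order_norm dG Gg (subsetP sQG y Qy)) => //.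
  by apply: contraNneq notQg => ->.
by rewrite (ordQ y).
Qed.

Theorem theorem6p6 (gT : finGroupType) (G : {group gT}) :
  hereditarily_d_maximal G <->
  ((exists (p q : nat) (x : gT) (Q : {group gT}),
      [/\ prime p /\ prime q, #[x] = p, Q ><| <[x]> = G, q.-abelem Q
        & acts_as_nontrivial_scalar q x Q])
   \/
   (exists p : nat, prime p /\ p.-abelem G)).
Proof.
split=> [dG |]; last first.
  case=> [[p [q [x [Q [[pr_p pr_q] ox defG abQ scal]]]]] | [p [_ abG]]].
    apply: fpf_power_extension_hereditary.
    exact: scalar_fpf_power_extension pr_p pr_q ox defG abQ scal.
  move=> H sHG K ltKH; have abH := abelemS sHG abG.
  rewrite (grank_abelem abH) (grank_abelem (abelemS (proper_sub ltKH) abH)).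
  exact: properG_ltn_log (abelem_pgroup abH) ltKH.
have [G1 | ntG] := eqVneq (G : {set gT}) 1.
  by right; exists 2; split=> //; rewrite G1 abelem1.
have [q [Q [[pr_q abQ] nsQG ntQ cQ nyG]]] := hdm_structure dG ntG.
have [sQG nQG] := andP nsQG.
have [defQ | neqQG] := eqVneq (Q : {set gT}) G.
  by right; exists q; rewrite -defQ.
left; have [y Qy nty] := trivgPn _ ntQ.
have pr_y : prime #|<[y]>| by rewrite -orderE (abelem_order_p abQ).
(* The kernel of f on G is contained in Q and its image is cyclic, so a
   preimage s of a generator generates G modulo Q. *)
pose f := conj_aut <[y]>.
have /cyclicP[fs def_fs] : cyclic (f @* G).
  exact: cyclicS (Aut_conj_aut _ _) (Aut_prime_cyclic pr_y).
have /morphimP[s nys Gs def_s] : fs \in f @* G by rewrite def_fs cycle_id.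
have defG : Q * <[s]> = G.
  apply/eqP; rewrite eqEsubset mul_subG ?cycle_subG //=; apply/subsetP=> g Gg.
  have Ng := subsetP (nyG y Qy) g Gg; have /cycleP[i fgi] : f g \in <[fs]>.
    by rewrite -def_fs mem_morphim.
  rewrite -(mulgKV (s ^+ i) g) mem_mulg ?mem_cycle //.
  apply: (subsetP (cQ y _)); first by rewrite !inE nty.
  rewrite inE groupM ?groupV ?groupX //= -cent_cycle -ker_conj_aut.
  apply/kerP; first by rewrite groupM ?groupV ?groupX.
  by rewrite morphM ?morphV ?morphX ?groupV ?groupX // -def_s -fgi mulgV.
have notQs : s \notin Q.
  by apply: contra neqQG => Qs; rewrite -defG mulGSid ?cycle_subG.
have pr_s : prime #[s].
  by apply: hdm_order_prime dG Gs _; apply: contraNneq notQs => ->.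
have powx z : z \in Q -> z ^ s \in <[z]>.
  by move=> Qz; rewrite memJ_norm ?cycle_id // (subsetP (nyG z Qz)).
have [n scal] := abelem_power_aut_scalar pr_q abQ powx.
have mov_y : y ^ s != y.
  apply: contra notQs => /eqP/conjg_fixP/commgP cys.
  apply: (subsetP (cQ y _)); first by rewrite !inE nty.
  by rewrite inE Gs; apply/cent1P.
exists #[s], q, s, Q; split=> //.
- rewrite sdprodE ?cycle_subG ?(subsetP nQG) //.
  by rewrite setIC prime_TIg ?cycle_subG.
split; last by exists y.
exists (n%:R)%R.
(* Elements of Q have order dividing q, so exponents matter only modulo q. *)
have scalF z : z \in Q -> z ^ s = z ^+ (n%:R : 'F_q)%R.
  move=> Qz; rewrite scal // val_Fp_nat //.
  have [-> | ntz] := eqVneq z 1; first by rewrite !expg1n.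
  by rewrite -[in RHS](abelem_order_p abQ Qz ntz) expg_mod_order.
split=> //; apply: contraNneq nty => n0.
by have /eqP := scalF y Qy; rewrite n0 expg0 conjg_eq1.
Qed.
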